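(* Let $J\subseteq\prod_{p\in\mathbb P}\mathbb J_p$ be a set of representatives in the sense that for each $\rho\in\prod_{p\in\mathbb P}\mathbb J_p$ there is $\tau\in J$ with $R_\tau\cong R_\rho$ (as rings), and for all $\tau,\sigma\in J$ with $\tau\neq\sigma$ one has $R_\tau\not\cong R_\sigma$. Put $A=\{\tau\in J\mid R_\tau\text{ is a PID}\}$ and $B=\{\tau\in J\mid R_\tau\text{ is not a UFD}\}$. Then $|A|=|B|=2^\omega$.
   Context: $\mathbb P$ is the set of all primes in $\mathbb N$. For $p\in\mathbb P$, $\mathbb J_p$ is the ring of $p$-adic integers, which contains $\mathbb Z$ canonically. For $k\ge 1$, $\pi_k:\mathbb J_p\to\mathbb Z/p^k\mathbb Z$ is the canonical projection, and $\pi_0:\mathbb J_p\to\{0\}$ is the zero map (the prime $p$ is suppressed in the notation). $\mathrm v_p$ is the usual $p$-adic valuation. For $\tau=(\tau_p)_{p\in\mathbb P}\in\prod_{p\in\mathbb P}\mathbb J_p$, define the subring of $\mathbb Q[x]$ $$R_\tau=\left\{\frac{h}{n}\in\mathbb Q[x]\ \Big|\ n\in\mathbb N\setminus\{0\},\ h\in\mathbb Z[x],\ \text{and } \pi_{\mathrm v_p(n)}(h(\tau_p))=0 \text{ for all } p\in\mathbb P\right\},$$ where $h(\tau_p)$ is evaluated in $\mathbb J_p$. Here $2^\omega$ denotes the cardinality of the continuum. *)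

(* Defs.v *)
From HB Require Import structures.
From mathcomp Require Import all_boot all_order all_algebra.
From mathcomp Require Import all_classical.

Set Implicit Arguments.
Unset Strict Implicit.
Unset Printing Implicit Defensive.

Import GRing.Theory.
Local Open Scope ring_scope.

Definition prime_number := {p : nat | prime p}.

(* J_p is the inverse limit of the rings Z/p^k, k >= 0. The residues mod p^k
   are 'I_(p ^ k) (a one-point type for k = 0) rather than 'Z_(p ^ k), which
   would be Z/2 for k = 0; [Zp_add], [Zp_opp] and [Zp_mul] are defined on 'I_n
   for every n. *)
Record padic_int (p : prime_number) := PadicInt {
  padic_proj : forall k : nat, 'I_(val p ^ k);
  padic_projP : forall k : nat,
    padic_proj k.+1 = padic_proj k %[mod val p ^ k]
}.

Section PadicRing.
Variable p : prime_number.
Implicit Types x y z : padic_int p.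
Local Notation pi k x := (padic_proj x k).

Lemma padic_eq x y : (forall k, pi k x = pi k y) -> x = y.
Proof.
case: x y => [f fP] [g gP] /= fgE.
have fg : f = g by exact: functional_extensionality_dep.
by subst g; congr PadicInt; exact: Prop_irrelevance.
Qed.

HB.instance Definition _ := gen_eqMixin (padic_int p).
HB.instance Definition _ := gen_choiceMixin (padic_int p).

Lemma pexp_gt0 k : (0 < val p ^ k)%N.
Proof. by rewrite expn_gt0 prime_gt0 //; exact: (valP p). Qed.

Lemma modn_pexpS m k : m %% val p ^ k.+1 = m %[mod val p ^ k].
Proof. by rewrite modn_dvdm // dvdn_exp2l. Qed.

Lemma padic_constP (n k : nat) :
  Ordinal (ltn_pmod n (pexp_gt0 k.+1)) = Ordinal (ltn_pmod n (pexp_gt0 k))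
    %[mod val p ^ k].
Proof. by rewrite /= modn_pexpS modn_mod. Qed.
Definition padic_const n := PadicInt (padic_constP n).

Lemma padic_addP x y k :
  Zp_add (pi k.+1 x) (pi k.+1 y) = Zp_add (pi k x) (pi k y) %[mod val p ^ k].
Proof.
by rewrite /= modn_pexpS modn_mod -modnDm !padic_projP modnDm.
Qed.
Definition padic_add x y := PadicInt (padic_addP x y).

Lemma padic_mulP x y k :
  Zp_mul (pi k.+1 x) (pi k.+1 y) = Zp_mul (pi k x) (pi k y) %[mod val p ^ k].
Proof.
by rewrite /= modn_pexpS modn_mod -modnMm !padic_projP modnMm.
Qed.
Definition padic_mul x y := PadicInt (padic_mulP x y).

Lemma padic_oppP x k :
  Zp_opp (pi k.+1 x) = Zp_opp (pi k x) %[mod val p ^ k].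
Proof.
rewrite /= modn_pexpS modn_mod; apply/eqP.
rewrite -(eqn_modDr (pi k.+1 x)) subnK; last exact: ltnW.
rewrite -modnDmr padic_projP modnDmr subnK; last exact: ltnW.
by rewrite modnn; exact: dvdn_exp2l.
Qed.
Definition padic_opp x := PadicInt (padic_oppP x).

Lemma padic_addA : associative padic_add.
Proof. by move=> x y z; apply: padic_eq => k; exact: Zp_addA. Qed.

Lemma padic_addC : commutative padic_add.
Proof. by move=> x y; apply: padic_eq => k; exact: Zp_addC. Qed.

Lemma padic_add0 : left_id (padic_const 0) padic_add.
Proof.
move=> x; apply: padic_eq => k; apply: val_inj => /=.
by rewrite mod0n add0n modn_small.
Qed.

Lemma padic_addN : left_inverse (padic_const 0) padic_opp padic_add.
Proof.
move=> x; apply: padic_eq => k; apply: val_inj => /=.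
by rewrite modnDml subnK ?modnn ?mod0n // ltnW.
Qed.

HB.instance Definition _ := GRing.isZmodule.Build (padic_int p)
  padic_addA padic_addC padic_add0 padic_addN.

Lemma padic_mulA : associative padic_mul.
Proof. by move=> x y z; apply: padic_eq => k; exact: Zp_mulA. Qed.

Lemma padic_mulC : commutative padic_mul.
Proof. by move=> x y; apply: padic_eq => k; exact: Zp_mulC. Qed.

Lemma padic_mul1 : left_id (padic_const 1) padic_mul.
Proof.
move=> x; apply: padic_eq => k; apply: val_inj => /=.
by rewrite modnMml mul1n modn_small.
Qed.

Lemma padic_mulDl : left_distributive padic_mul padic_add.
Proof. by move=> x y z; apply: padic_eq => k; exact: Zp_mul_addl. Qed.

Lemma padic_1neq0 : padic_const 1 != 0.
Proof.
apply/eqP => /(congr1 (fun x => val (pi 1 x))) /=.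
by rewrite mod0n modn_small ?expn1 // prime_gt1 //; exact: (valP p).
Qed.

HB.instance Definition _ := GRing.Zmodule_isComNzRing.Build (padic_int p)
  padic_mulA padic_mulC padic_mul1 padic_mulDl padic_1neq0.

Lemma padic_projD x y k :
  pi k (x + y) = ((pi k x + pi k y) %% val p ^ k)%N :> nat.
Proof. by []. Qed.

Lemma padic_projM x y k :
  pi k (x * y) = ((pi k x * pi k y) %% val p ^ k)%N :> nat.
Proof. by []. Qed.

Lemma padic_proj_nat n k : pi k n%:R = (n %% val p ^ k)%N :> nat.
Proof.
elim: n => [//|n IHn]; rewrite -addn1 natrD padic_projD IHn.
by rewrite modnDm.
Qed.

Lemma padic_proj_modl x a b : pi (a + b) x = pi a x %[mod val p ^ a].
Proof.
elim: b => [|b IHb]; first by rewrite addn0.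
rewrite addnS -IHb -(modn_dvdm (pi _.+1 x) (dvdn_exp2l (val p) (leq_addr b a))).
by rewrite padic_projP modn_dvdm // dvdn_exp2l // leq_addr.
Qed.

Lemma padic_projM0 x y a b :
  pi a x = 0%N :> nat -> pi b y = 0%N :> nat ->
  pi (a + b) (x * y) = 0%N :> nat.
Proof.
move=> x0 y0; rewrite padic_projM; apply/eqP; rewrite -/(dvdn _ _).
apply: (@dvdn_trans (val p ^ a * val p ^ b)); first by rewrite expnD.
apply: dvdn_mul; first by rewrite /dvdn padic_proj_modl x0 mod0n.
by rewrite addnC /dvdn padic_proj_modl y0 mod0n.
Qed.

End PadicRing.

Definition padic_family := forall p : prime_number, padic_int p.

Definition padic_eval (p : prime_number) (h : {poly int}) (x : padic_int p) :
  padic_int p := (map_poly intr h).[x].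

Definition Rtau (tau : padic_family) : {pred {poly rat}} :=
  [pred q | `[< exists (n : nat) (h : {poly int}),
    [/\ (0 < n)%N,
        q = n%:R^-1 *: map_poly intr h
      & forall p : prime_number,
          padic_proj (padic_eval h (tau p)) (logn (val p) n) = 0%N :> nat] >]].

Section RtauRing.
Variable tau : padic_family.

Lemma padic_evalD p (g h : {poly int}) (x : padic_int p) :
  padic_eval (g + h) x = padic_eval g x + padic_eval h x.
Proof. by rewrite /padic_eval rmorphD hornerD. Qed.

Lemma padic_evalM p (g h : {poly int}) (x : padic_int p) :
  padic_eval (g * h) x = padic_eval g x * padic_eval h x.
Proof. by rewrite /padic_eval rmorphM hornerM. Qed.

Lemma padic_evalC p (c : int) (x : padic_int p) :
  padic_eval c%:P x = c%:~R.
Proof. by rewrite /padic_eval map_polyC hornerC. Qed.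

Lemma padic_proj_nat_logn (p : prime_number) n :
  padic_proj (n%:R : padic_int p) (logn (val p) n) = 0%N :> nat.
Proof. by rewrite padic_proj_nat; apply/eqP; exact: pfactor_dvdnn. Qed.

Lemma Rtau_subring_closed : subring_closed (Rtau tau).
Proof.
have RM : {in Rtau tau &, forall u v, u * v \in Rtau tau}.
  move=> u v /asboolP[n [g [n0 -> gP]]] /asboolP[m [h [m0 -> hP]]].
  apply/asboolP; exists (n * m)%N, (g * h); split=> [||p].
  - by rewrite muln_gt0 n0.
  - rewrite natrM invfM [map_poly _ (_ * _)]rmorphM.
    by rewrite -scalerAl -scalerAr scalerA.
  - by rewrite padic_evalM lognM //; exact: padic_projM0.
have RC (c : int) : (c%:~R)%:P \in Rtau tau.
  apply/asboolP; exists 1%N, c%:P; split=> // [|p].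
    by rewrite invr1 scale1r map_polyC.
  by rewrite logn1; case: (padic_proj _ _) => -[].
have RD : {in Rtau tau &, forall u v, u + v \in Rtau tau}.
  move=> u v /asboolP[n [g [n0 -> gP]]] /asboolP[m [h [m0 -> hP]]].
  apply/asboolP; exists (n * m)%N, (g * m%:Z%:P + h * n%:Z%:P); split=> [||p].
  - by rewrite muln_gt0 n0.
  - have nz k : (0 < k)%N -> k%:R != 0 :> rat.
      by move=> k0; rewrite Num.Theory.pnatr_eq0 -lt0n.
    rewrite natrM invfM [map_poly _ (_ + _)]rmorphD /=.
    rewrite [map_poly _ (g * _)]rmorphM [map_poly _ (h * _)]rmorphM /=.
    rewrite !map_polyC /=.
    rewrite ![_ * _%:P]mulrC !mul_polyC scalerDr !scalerA -!pmulrn.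
    by rewrite divfK ?nz // mulrAC mulVf ?nz // mul1r.
  - rewrite padic_evalD padic_projD !padic_evalM !padic_evalC lognM //.
    rewrite (padic_projM0 (gP p) (padic_proj_nat_logn p m)) add0n modn_small //.
    by rewrite addnC; exact: padic_projM0 (hP p) (padic_proj_nat_logn p n).
split=> // [|u v uR vR]; first by have := RC 1; rewrite mulr1z.
apply: RD => //; rewrite -mulN1r; apply: RM => //.
by have := RC (-1); rewrite mulrN1z polyCN.
Qed.

HB.instance Definition _ :=
  GRing.isSubringClosed.Build {poly rat} (Rtau tau) Rtau_subring_closed.

End RtauRing.

Record Rtau_ring (tau : padic_family) := RtauElt {
  Rtau_val : {poly rat};
  _ : Rtau_val \in Rtau tau
}.

HB.instance Definition _ tau := [isSub for @Rtau_val tau].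
HB.instance Definition _ tau := [Choice of Rtau_ring tau by <:].
HB.instance Definition _ tau :=
  [SubChoice_isSubComNzRing of Rtau_ring tau by <:].

Definition ring_isomorphic (R S : nzRingType) : Prop :=
  exists f : {rmorphism R -> S}, bijective f.

Section FactorialRings.
Variable R : comNzRingType.
Implicit Types (a b x y : R) (I : set R) (s t : seq R).

Definition is_ideal I : Prop :=
  [/\ I 0, forall x y, I x -> I y -> I (x + y) & forall a x, I x -> I (a * x)].

Definition is_domain : Prop := forall x y, x * y = 0 -> x = 0 \/ y = 0.

Definition is_PID : Prop :=
  is_domain /\
  forall I, is_ideal I -> exists a, I = [set x | exists b, x = b * a]%classic.

Definition is_unit x : Prop := exists y, x * y = 1.

Definition associated x y : Prop := exists2 u, is_unit u & y = u * x.

Definition is_irreducible x : Prop :=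
  [/\ x <> 0, ~ is_unit x
    & forall a b, x = a * b -> is_unit a \/ is_unit b].

Definition all_irreducible s : Prop := forall x, x \in s -> is_irreducible x.

Definition is_UFD : Prop :=
  [/\ is_domain,
      forall x, x <> 0 -> ~ is_unit x ->
        exists2 s, all_irreducible s & x = \prod_(a <- s) a
    & forall s t, all_irreducible s -> all_irreducible t ->
        \prod_(a <- s) a = \prod_(a <- t) a ->
        exists t', [/\ perm_eq t t', size s = size t'
          & forall i, (i < size s)%N -> associated s`_i t'`_i]].

End FactorialRings.

(* Main.v *)
Require Import Defs.
From HB Require Import structures.
From mathcomp Require Import all_boot all_order all_algebra.
From mathcomp Require Import all_classical.
From mathcomp Require Import zify ring.

(** Write v_p for the p-adic valuation and call tau generic if, for every
    nonzero h in Z[x], all values h(tau_p) are nonzero and almost all of them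
    are units.

    If tau is generic, then R_tau is a PID. A nonzero h in Z[x] has a content,
    the product c of the prime powers p ^ v_p(h(tau_p)) ([content_exists]), and
    f = h / c divides a member of R_tau inside R_tau as soon as it divides it
    in Q[x] ([content_cancel]). Applied to an element of least degree of an
    ideal I, this writes I = f I', where I' contains a positive integer
    ([ideal_primitive_factor]). By the Chinese remainder theorem Z maps onto
    R_tau / d R_tau for every d > 0 ([Rtau_division]), so I' is generated by
    its least positive integer ([generic_PID]).

    If rho_2 = 0, then 2 ^ k divides x in R_rho for all k. The integer 2 is
    irreducible in every R_sigma ([two_irreducible]), so a ring R_sigma that is
    isomorphic to R_rho cannot be a UFD: a factorization of the element that
    corresponds to x would have more than k factors for every k
    ([infinitely_even_not_UFD]).

    Both kinds of tau come in injective families indexed by the Cantor space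
    nat -> bool. For the second kind the coordinates away from 2 are arbitrary.
    For the first kind ([generic_family]) take
    tau_p = floor (log_2 p) + p y_p, chosen transcendental over Q. For large n
    one has 0 < |h(n)| < 2 ^ n, and with n = floor (log_2 p) this gives
    0 < |h(n)| < p, so that p does not divide h(tau_p).

    Finally, passing to representatives in J keeps continuum many rings. An
    isomorphism f : R_sigma -> R_rho is determined by the polynomial f(x),
    because f(h / n) = h(f(x)) / n; hence so is its image R_rho, and hence rho
    ([iso_image_X_inj]). As Q[x] is countable, each isomorphism class is
    countable, and a diagonal argument shows that in any colouring of the Cantor
    space by countably many colours some colour class contains an injective
    image of the whole space ([cantor_color_class]). The same argument provides
    the transcendental coordinates: each nonzero h has finitely many roots in
    J_p and there are countably many h. *)

Set Implicit Arguments.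
Unset Strict Implicit.
Unset Printing Implicit Defensive.

Import Order.TTheory GRing.Theory Num.Theory.
Local Open Scope ring_scope.

(** * Divisibility by powers of p in J_p *)

Definition pdvd (p : prime_number) (k : nat) (x : padic_int p) : bool :=
  padic_proj x k == 0%N :> nat.

Lemma pdvd0n (p : prime_number) (x : padic_int p) : pdvd 0 x.
Proof. by rewrite /pdvd; case: (padic_proj x 0) => -[]. Qed.

Lemma pdvd_dvdn (p : prime_number) (k l : nat) (x : padic_int p) :
  (k <= l)%N -> pdvd k x = (val p ^ k %| padic_proj x l)%N.
Proof.
move=> /subnKC <-; rewrite /pdvd /dvdn padic_proj_modl modn_small //.
Qed.

Lemma pdvd_le (p : prime_number) (j k : nat) (x : padic_int p) :
  (j <= k)%N -> pdvd k x -> pdvd j x.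
Proof. by move=> jk /eqP x0; rewrite (pdvd_dvdn _ jk) x0 dvdn0. Qed.

Lemma pdvd_nat (p : prime_number) (k n : nat) :
  pdvd k (n%:R : padic_int p) = (val p ^ k %| n)%N.
Proof. by rewrite /pdvd padic_proj_nat. Qed.

Lemma pdvd0 (p : prime_number) (k : nat) : pdvd k (0 : padic_int p).
Proof. by rewrite (pdvd_nat p k 0) dvdn0. Qed.

Lemma pdvdD (p : prime_number) (k : nat) (x y : padic_int p) :
  pdvd k x -> pdvd k y -> pdvd k (x + y).
Proof. by move=> /eqP x0 /eqP y0; rewrite /pdvd padic_projD x0 y0 mod0n. Qed.

Lemma pdvdMr (p : prime_number) (k : nat) (x y : padic_int p) :
  pdvd k x -> pdvd k (x * y).
Proof. by move=> /eqP x0; rewrite /pdvd padic_projM x0 mul0n mod0n. Qed.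

Lemma pdvdMl (p : prime_number) (k : nat) (x y : padic_int p) :
  pdvd k y -> pdvd k (x * y).
Proof. by rewrite mulrC; exact: pdvdMr. Qed.

Lemma pdvdN (p : prime_number) (k : nat) (x : padic_int p) :
  pdvd k (- x) = pdvd k x.
Proof.
apply/idP/idP => /pdvdMr H; first by rewrite -[x]opprK -mulrN1; exact: H.
by rewrite -mulrN1; exact: H.
Qed.

Lemma pdvdB (p : prime_number) (k : nat) (x y : padic_int p) :
  pdvd k (x - y) = (padic_proj x k == padic_proj y k).
Proof.
apply/idP/eqP => [xy|xy].
  apply: val_inj; rewrite /= -[x in LHS](subrK y) padic_projD (eqP xy) add0n.
  by rewrite modn_small.
have : pdvd k (y - y) by rewrite subrr; exact: pdvd0.
by rewrite /pdvd !padic_projD xy.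
Qed.

Lemma pdvd_int (p : prime_number) (k : nat) (m : int) :
  pdvd k (m%:~R : padic_int p) = (val p ^ k %| `|m|)%N.
Proof.
by case: m => n /=; rewrite ?NegzE ?mulrNz ?pdvdN ?abszN -pmulrn pdvd_nat.
Qed.

(** The exact power p ^ a of p in x can be cancelled. For natural residues
    modulo a power of p beyond both exponents this is Gauss's lemma. *)
Lemma pdvd_cancel (p : prime_number) (a b : nat) (x y : padic_int p) :
  pdvd a x -> ~~ pdvd a.+1 x -> pdvd (a + b) (x * y) -> pdvd b y.
Proof.
have pp := valP p.
(* Residues at this level see all four powers of p that occur. *)
set l := (a + b).+1.
have al : (a <= l)%N by rewrite /l; lia.
have bl : (b <= l)%N by rewrite /l; lia.
have abl : (a + b <= l)%N by rewrite /l.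
have a1l : (a.+1 <= l)%N by rewrite /l; lia.
rewrite (pdvd_dvdn _ al) (pdvd_dvdn _ bl) (pdvd_dvdn _ abl) (pdvd_dvdn _ a1l).
rewrite padic_projM /dvdn modn_dvdm; last exact: dvdn_exp2l.
rewrite -![(_ %% _ == 0)%N]/(dvdn _ _).
move: (nat_of_ord (padic_proj x l)) (nat_of_ord (padic_proj y l)) => X Y.
case/dvdnP => Z ->; rewrite expnS dvdn_pmul2r ?pexp_gt0 // => pZ.
rewrite -mulnA mulnCA expnD dvdn_pmul2l ?pexp_gt0 //.
by rewrite Gauss_dvdr // coprimeXl // prime_coprime.
Qed.

Lemma padic_valuation_ex (p : prime_number) (x : padic_int p) :
  x != 0 -> exists2 a, pdvd a x & ~~ pdvd a.+1 x.
Proof.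
move=> x0.
have ex : exists k, ~~ pdvd k x.
  apply: contrapT => H; move/eqP: x0; apply; apply: padic_eq => k.
  apply: val_inj => /=; rewrite mod0n; apply/eqP.
  by apply/negPn/negP => nk; apply: H; exists k.
case: (ex_minnP ex) => -[|a] na mina; first by rewrite pdvd0n in na.
by exists a => //; apply/negPn/negP => /mina; rewrite ltnn.
Qed.

Lemma padic_domain (p : prime_number) : is_domain (padic_int p).
Proof.
move=> x y xy; case: (eqVneq x 0) => [->|x0]; [by left|right].
have [a ax nax] := padic_valuation_ex x0.
apply: padic_eq => b; apply/eqP; rewrite -pdvdB subr0.
apply: (pdvd_cancel ax nax).
by rewrite xy; exact: pdvd0.
Qed.

Lemma padic_int_eq0 (p : prime_number) (m : int) :
  ((m%:~R : padic_int p) == 0) = (m == 0).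
Proof.
apply/eqP/eqP => [m0|->//]; apply/eqP; rewrite -absz_eq0.
apply/negPn/negP => nz.
have := pdvd_int p `|m|%N m; rewrite m0.
have -> : pdvd `|m| (0 : padic_int p) by exact: pdvd0.
move=> /esym /dvdn_leq; rewrite lt0n => /(_ nz).
by rewrite leqNgt ltn_expl // prime_gt1 //; exact: (valP p).
Qed.

Lemma pdvd_pnat_cancel (p : prime_number) (n k : nat) (x : padic_int p) :
  (0 < n)%N -> pdvd (logn (val p) n + k) (n%:R * x) -> pdvd k x.
Proof.
move=> n0; apply: pdvd_cancel; rewrite pdvd_nat pfactor_dvdn ?(valP p) //.
by rewrite ltnn.
Qed.

Lemma pdvd_natM (p : prime_number) (n k : nat) (x : padic_int p) :
  pdvd k x -> pdvd (logn (val p) n + k) (n%:R * x).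
Proof.
move=> /eqP kx; apply/eqP; apply: padic_projM0 => //.
exact: padic_proj_nat_logn.
Qed.

Lemma padic_evalX (p : prime_number) (x : padic_int p) :
  padic_eval 'X x = x.
Proof. by rewrite /padic_eval map_polyX hornerX. Qed.

Lemma padic_eval_natr (p : prime_number) (n : nat) (x : padic_int p) :
  padic_eval n%:R x = n%:R.
Proof. by rewrite /padic_eval rmorph_nat -polyC_natr hornerC. Qed.

Lemma padic_evalB (p : prime_number) (g h : {poly int}) (x : padic_int p) :
  padic_eval (g - h) x = padic_eval g x - padic_eval h x.
Proof. by rewrite /padic_eval rmorphB hornerD hornerN. Qed.

Lemma pdvd_eval (p : prime_number) (k : nat) (h : {poly int})
    (x y : padic_int p) :
  pdvd k (x - y) -> pdvd k (padic_eval h x - padic_eval h y).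
Proof.
move=> xy; elim/poly_ind: h => [|h c IH].
  by rewrite /padic_eval rmorph0 !horner0 subrr; exact: pdvd0.
rewrite !padic_evalD !padic_evalM !padic_evalX !padic_evalC.
rewrite (_ : _ - _ = (padic_eval h x - padic_eval h y) * x +
  padic_eval h y * (x - y)); last by ring.
by apply: pdvdD; [exact: pdvdMr|exact: pdvdMl].
Qed.

Lemma padic_eval_nat (p : prime_number) (h : {poly int}) (n : nat) :
  padic_eval h (n%:R : padic_int p) = (h.[n%:Z])%:~R.
Proof. by rewrite /padic_eval -horner_map /= -pmulrn. Qed.

Lemma padic_map_poly_eq0 (p : prime_number) (h : {poly int}) :
  (map_poly intr h == 0 :> {poly padic_int p}) = (h == 0).
Proof.
apply/eqP/eqP => [h0|->]; last by rewrite rmorph0.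
apply/polyP => i; rewrite coef0; apply/eqP.
by rewrite -(padic_int_eq0 p) -coef_map h0 coef0.
Qed.

Lemma dvdn_logn (m n : nat) : (0 < m)%N ->
  (forall p, prime p -> p ^ logn p m %| n)%N -> (m %| n)%N.
Proof.
move=> m0 H; have [->//|n0] := posnP n.
apply/dvdn_partP => // p; rewrite mem_primes => /andP[pp _].
by rewrite p_part H.
Qed.

(** * Membership in R_tau *)

(** The fixed target type keeps the ring structure on the coefficients of the
    image canonical. *)
Definition Qpoly (h : {poly int}) : {poly rat} := map_poly intr h.

Lemma QpolyB (g h : {poly int}) : Qpoly (g - h) = Qpoly g - Qpoly h.
Proof. exact: rmorphB. Qed.

Lemma QpolyM (g h : {poly int}) : Qpoly (g * h) = Qpoly g * Qpoly h.
Proof. exact: rmorphM. Qed.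

Lemma QpolyC (m : int) : Qpoly m%:P = m%:~R%:P.
Proof. exact: map_polyC. Qed.

Lemma QpolyX : Qpoly 'X = 'X.
Proof. exact: map_polyX. Qed.

Lemma Qpoly_nat (n : nat) : Qpoly n%:R = n%:R.
Proof. exact: rmorph_nat. Qed.

Lemma Qpoly_inj : injective Qpoly.
Proof. by apply: map_inj_poly; [exact: intr_inj|]. Qed.

Lemma rat_poly_frac (q : {poly rat}) :
  exists (n : nat) (h : {poly int}), (0 < n)%N /\ q = n%:R^-1 *: Qpoly h.
Proof.
have [h [a a0 ->]] := rat_poly_scale q.
exists `|a|%N, ((sgz a)%:P * h); split; first by rewrite lt0n absz_eq0.
rewrite QpolyM QpolyC mul_polyC scalerA; congr (_ *: _).
have a0' : (`|a|%N)%:R != 0 :> rat by rewrite pnatr_eq0 absz_eq0.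
apply: (mulfI a0'); rewrite mulrA divff // mul1r.
rewrite [X in X%:~R^-1]intEsg rmorphM /= -pmulrn invfM mulrCA divff // mulr1.
by case: (sgzP a) a0.
Qed.

(** Membership in [Rtau] asks for some representation of q as a fraction; it may
    be tested on any one of them, since cross-multiplying two representations
    and cancelling the power of p in the denominator transfers the condition. *)
Lemma Rtau_frac (tau : padic_family) (n : nat) (h : {poly int}) : (0 < n)%N ->
  n%:R^-1 *: Qpoly h \in Rtau tau <->
  forall p, pdvd (logn (val p) n) (padic_eval h (tau p)).
Proof.
move=> n0; split; last first.
  by move=> H; apply/asboolP; exists n, h; split => // p; exact/eqP/H.
case/asboolP => m [g [m0]]; rewrite -/(Qpoly g) => E H p.
have nz k : (0 < k)%N -> k%:R != 0 :> rat by rewrite pnatr_eq0 -lt0n.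
have {}E : m%:R * h = n%:R * g.
  apply: Qpoly_inj; rewrite !QpolyM !Qpoly_nat.
  have -> : Qpoly h = n%:R *: (n%:R^-1 *: Qpoly h).
    by rewrite scalerA divff ?nz // scale1r.
  rewrite E !mulr_natl -!scaler_nat !scalerA.
  by rewrite mulrC divfK ?nz.
apply: (pdvd_pnat_cancel m0).
have := congr1 (fun f => padic_eval f (tau p)) E.
rewrite /= !padic_evalM !padic_eval_natr => ->.
rewrite addnC; apply: pdvd_natM; exact/eqP/H.
Qed.

Lemma Rtau_int (tau : padic_family) (h : {poly int}) : Qpoly h \in Rtau tau.
Proof.
have := @Rtau_frac tau 1 h isT; rewrite invr1 scale1r => ->.
by move=> p; rewrite logn1 pdvd0n.
Qed.

(** A rational number in R_tau has a denominator that divides its numerator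
    locally at every prime, so it is an integer. *)
Lemma Rtau_const (tau : padic_family) (c : rat) :
  c%:P \in Rtau tau -> exists m : int, c = m%:~R.
Proof.
have d0 : (0 < `|denq c|)%N by rewrite absz_gt0 denq_eq0.
have cE : c = (`|denq c|%N)%:R^-1 * (numq c)%:~R.
  by rewrite pmulrn absz_denq mulrC divq_num_den.
have -> : c%:P = (`|denq c|%N)%:R^-1 *: Qpoly (numq c)%:P.
  by rewrite QpolyC -mul_polyC -polyCM -cE.
move/(Rtau_frac _ _ d0) => H.
have /dvdnP[k kE] : (`|denq c| %| `|numq c|)%N.
  apply: dvdn_logn => // p pp.
  by have := H (exist _ p pp); rewrite padic_evalC pdvd_int.
exists (sgz (numq c) * k%:Z); rewrite [LHS]cE [numq c in LHS]intEsg kE.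
rewrite PoszM mulrA [X in _ * X]rmorphM /= -pmulrn mulrC mulfK //.
by rewrite pnatr_eq0 -lt0n.
Qed.

Lemma Rtau_domain (tau : padic_family) : is_domain (Rtau_ring tau).
Proof.
move=> x y /(congr1 val) /eqP; rewrite rmorphM rmorph0 mulf_eq0.
by case/orP => /eqP H; [left|right]; apply: val_inj; rewrite H rmorph0.
Qed.

(** * Integers are dense in R_tau *)

Lemma chinese_seq (s : seq nat) (e c : nat -> nat) :
  uniq s -> all prime s ->
  exists b, forall q, q \in s -> (b = c q %[mod q ^ e q])%N.
Proof.
elim: s => [|p s IH] /=; first by exists 0%N.
case/andP=> ps us /andP[pp pps]; have [b Hb] := IH us pps.
pose M := (\prod_(q <- s) q ^ e q)%N.
have cop : coprime (p ^ e p) M.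
  rewrite coprimeXl // /M big_seq; elim/big_ind: _ => [|x y|q qs].
  - exact: coprimen1.
  - by rewrite coprimeMr => -> ->.
  rewrite coprimeXr // prime_coprime // dvdn_prime2 ?(allP pps q qs) //.
  by apply: contra ps => /eqP ->.
exists (chinese (p ^ e p)%N M (c p) b) => q; rewrite inE => /orP[/eqP ->|qs].
  exact: chinese_modl.
have qM : (q ^ e q %| M)%N by rewrite /M (big_rem q) //= dvdn_mulr.
by rewrite -Hb // -(modn_dvdm _ qM) chinese_modr // modn_dvdm.
Qed.

Lemma padic_family_approx (x : padic_family) (D : nat) : (0 < D)%N ->
  exists b : nat, forall p, pdvd (logn (val p) D) (x p - b%:R).
Proof.
move=> D0.
pose c q := if insub q is Some p
  then nat_of_ord (padic_proj (x p) (logn q D)) else 0%N.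
have ap : all prime (primes D).
  by apply/allP => q; rewrite mem_primes => /andP[].
have [b Hb] := chinese_seq (logn^~ D) c (primes_uniq D) ap.
exists b => p; case: (boolP (val p \in primes D)) => pD; last first.
  move: pD; rewrite -logn_gt0 -eqn0Ngt => /eqP ->.
  exact: pdvd0n.
rewrite pdvdB -val_eqE /= padic_proj_nat Hb // /c insubT ?(valP p) // => pp.
have -> : Sub (val p) pp = p by apply: val_inj.
by rewrite modn_small.
Qed.

(** Approximating u(tau_p) modulo m d, rather than modulo d, makes the
    approximating integer b divisible by m, because m already divides u(tau_p)
    at every prime; a = b / m is the integer sought. *)
Lemma Rtau_approx (tau : padic_family) (k : {poly rat}) (d : nat) :
  (0 < d)%N -> k \in Rtau tau ->
  exists a : nat, d%:R^-1 *: (k - a%:R) \in Rtau tau.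
Proof.
move=> d0; have [m [u [m0 ->]]] := rat_poly_frac k.
move/(Rtau_frac _ _ m0) => H.
have md0 : (0 < m * d)%N by rewrite muln_gt0 m0.
have [b Hb] := padic_family_approx (fun p => padic_eval u (tau p)) md0.
have /dvdnP[a ab] : (m %| b)%N.
  apply: dvdn_logn => // p pp; pose P : prime_number := exist _ p pp.
  rewrite -(pdvd_nat P).
  rewrite -[b%:R](subKr (padic_eval u (tau P))).
  apply: pdvdD => //; rewrite pdvdN.
  apply: pdvd_le (Hb P) => /=; rewrite lognM //; exact: leq_addr.
exists a.
have -> : d%:R^-1 *: (m%:R^-1 *: Qpoly u - a%:R) =
   (m * d)%:R^-1 *: Qpoly (u - b%:R).
  rewrite QpolyB Qpoly_nat ab natrM invfM [m%:R^-1 * _]mulrC -scalerA.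
  congr (_ *: _); rewrite scalerBr; congr (_ - _).
  have -> : (a * m)%:R = m%:R *: a%:R :> {poly rat}.
    by rewrite scaler_nat -mulrnA.
  rewrite scalerA mulVf ?scale1r //.
  by rewrite pnatr_eq0 -lt0n.
apply/Rtau_frac => // p.
by rewrite padic_evalB padic_eval_natr.
Qed.

(** * Generic families give principal ideal domains *)

Definition generic (tau : padic_family) : Prop :=
  forall h : {poly int}, h != 0 ->
    (forall p, padic_eval h (tau p) != 0) /\
    (exists N, forall p : prime_number, (N <= val p)%N ->
       ~~ pdvd 1 (padic_eval h (tau p))).

Lemma logn_prod_expn (N : nat) (e : nat -> nat) (p : nat) : prime p ->
  logn p (\prod_(q < N | prime q) q ^ e q) = if (p < N)%N then e p else 0%N.
Proof.
move=> pp; elim: N => [|N IH]; first by rewrite big_ord0 logn1.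
rewrite big_mkcond big_ord_recr -big_mkcond /=.
have pr0 : (0 < \prod_(q < N | prime q) q ^ e q)%N.
  by apply: prodn_cond_gt0 => q pq; rewrite expn_gt0 prime_gt0.
case: ifP => pN; rewrite ?muln1 ?lognM // ?expn_gt0 ?prime_gt0 // IH ltnS.
  rewrite lognX logn_prime //; case: ltngtP => //= [||<-];
  by rewrite ?muln0 ?muln1 ?addn0.
by case: ltngtP => // pE; rewrite pE pN in pp.
Qed.

Definition is_content (tau : padic_family) (h : {poly int}) (c : nat) : Prop :=
  forall p, pdvd (logn (val p) c) (padic_eval h (tau p)) /\
            ~~ pdvd (logn (val p) c).+1 (padic_eval h (tau p)).

(** The valuation of each h(tau_p) exists because the value is nonzero, and it is
    zero for almost all p, so the product of the p ^ v_p(h(tau_p)) is finite. *)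
Lemma content_exists (tau : padic_family) (h : {poly int}) :
  generic tau -> h != 0 -> exists2 c : nat, (0 < c)%N & is_content tau h c.
Proof.
move=> gen /gen [nz [N HN]].
have /choice[e He] : forall q : nat, exists a : nat, forall p : prime_number,
    val p = q -> pdvd a (padic_eval h (tau p)) /\
                 ~~ pdvd a.+1 (padic_eval h (tau p)).
  move=> q; case: (boolP (prime q)) => pq; last first.
    by exists 0%N => p pE; move: (valP p); rewrite pE (negbTE pq).
  have [a ? ?] := padic_valuation_ex (nz (exist _ q pq)).
  exists a => p pE; have -> : p = exist _ q pq by apply: val_inj.
  by split.
exists (\prod_(q < N | prime q) q ^ e q)%N.
  by apply: prodn_cond_gt0 => q pq; rewrite expn_gt0 prime_gt0.
move=> p; rewrite logn_prod_expn ?(valP p) //.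
case: ltnP => pN; first exact: He.
by split; [exact: pdvd0n|exact: HN].
Qed.

(** A Gauss lemma: a polynomial of content one that divides a member of R_tau in
    Q[x] has its cofactor in R_tau. *)
Lemma content_cancel (tau : padic_family) (c : nat) (h : {poly int})
    (k : {poly rat}) : (0 < c)%N -> is_content tau h c ->
  (c%:R^-1 *: Qpoly h) * k \in Rtau tau -> k \in Rtau tau.
Proof.
move=> c0 Hc; have [m [u [m0 ->]]] := rat_poly_frac k.
have -> : (c%:R^-1 *: Qpoly h) * (m%:R^-1 *: Qpoly u) =
    (c * m)%:R^-1 *: Qpoly (h * u).
  by rewrite QpolyM -scalerAl -scalerAr scalerA natrM invfM.
have cm0 : (0 < c * m)%N by rewrite muln_gt0 c0.
move/(Rtau_frac _ _ cm0) => H; apply/Rtau_frac => // p.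
have [cp ncp] := Hc p; apply: (pdvd_cancel cp ncp).
by rewrite -padic_evalM -lognM //; exact: H.
Qed.

Lemma idealB (R : comNzRingType) (I : set R) (x y : R) :
  is_ideal I -> I x -> I y -> I (x - y).
Proof.
by case=> _ ID IM Ix Iy; apply: ID => //; rewrite -mulN1r; exact: IM.
Qed.

Lemma nat_minimum (P : nat -> Prop) : (exists n, P n) ->
  exists2 n, P n & forall m, P m -> (n <= m)%N.
Proof.
case=> n0 Pn0; have ex : exists n, `[< P n >] by exists n0; exact/asboolP.
case: (ex_minnP ex) => n /asboolP Pn mn; exists n => // m Pm.
by apply: mn; exact/asboolP.
Qed.

(** The factor F is an element of I of least degree, divided by its content.
    Division with remainder in Q[x], after clearing the denominator of the
    quotient, stays inside I and so leaves no remainder; [content_cancel] then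
    brings the quotient into R_tau. *)
Lemma ideal_primitive_factor (tau : padic_family) (I : set (Rtau_ring tau))
    (g0 : Rtau_ring tau) :
  generic tau -> is_ideal I -> I g0 -> g0 <> 0 ->
  exists F : Rtau_ring tau,
    (forall g, I g -> exists k, g = F * k) /\
    (exists2 c : nat, (0 < c)%N & I (F * c%:R)).
Proof.
move=> gen Iid Ig0 g0n.
have [I0 ID IM] := Iid.
have [s [f [If [fn fs]]] smin] : exists2 s : nat,
    (exists f, I f /\ f <> 0 /\ size (val f) = s) &
    forall s', (exists f, I f /\ f <> 0 /\ size (val f) = s') -> (s <= s')%N.
  by apply: nat_minimum; exists (size (val g0)), g0.
have vf0 : val f != 0.
  by apply/eqP => vf0; apply: fn; apply: val_inj; rewrite vf0 rmorph0.
have dvd_f (g : Rtau_ring tau) : I g -> val g = val f * (val g %/ val f).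
  move=> Ig; set q := _ %/ _.
  have gE : val g = q * val f + (val g %% val f) := divp_eq _ _.
  have [N [Q [N0 qE]]] := rat_poly_frac q.
  have NR : N%:R != 0 :> rat by rewrite pnatr_eq0 -lt0n.
  (* N times the remainder of g modulo f, but formed inside the ideal. *)
  pose r : Rtau_ring tau := N%:R * g - RtauElt (Rtau_int tau Q) * f.
  have Ir : I r by apply: idealB => //; exact: IM.
  have rE : val r = N%:R *: (val g %% val f).
    rewrite /r rmorphB !rmorphM rmorph_nat /= -/(val g).
    have -> : Qpoly Q = N%:R *: q by rewrite qE scalerA divff // scale1r.
    rewrite [in LHS]gE mulrDr mulr_natl -scaler_nat -scalerAl.
    by rewrite addrAC subrr add0r mulr_natl scaler_nat.
  have [r0|rn0] := eqVneq (val g %% val f) 0.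
    by rewrite gE r0 addr0 mulrC.
  have /smin : exists f, I f /\ f <> 0 /\ size (val f) = size (val r).
    exists r; split=> //; split=> // r0; move/eqP: rn0; apply.
    apply/eqP; move: rE; rewrite r0 rmorph0 => /esym/eqP.
    by rewrite scaler_eq0 (negbTE NR).
  by rewrite rE size_scale // -fs leqNgt ltn_modp vf0.
have [n [h [n0 fE]]] := rat_poly_frac (val f).
have h0 : h != 0.
  by apply: contra vf0 => /eqP h0; rewrite fE h0 /Qpoly rmorph0 scaler0.
have [c c0 Hc] := content_exists gen h0.
have cR : c%:R != 0 :> rat by rewrite pnatr_eq0 -lt0n.
have nR : n%:R != 0 :> rat by rewrite pnatr_eq0 -lt0n.
have FR : c%:R^-1 *: Qpoly h \in Rtau tau.
  by apply/Rtau_frac => // p; case: (Hc p).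
exists (RtauElt FR); split; last first.
  exists c => //.
  have -> : RtauElt FR * c%:R = n%:R * f.
    apply: val_inj; rewrite !rmorphM !rmorph_nat /= fE mulr_natl mulr_natr.
    by rewrite -(scaler_nat c) -(scaler_nat n (_ *: _)) !scalerA !divff.
  exact: IM.
move=> g Ig; pose k := (c%:R / n%:R) *: (val g %/ val f).
have gE : val g = (c%:R^-1 *: Qpoly h) * k.
  rewrite dvd_f // {1}fE /k -!scalerAl -scalerAr scalerA; congr (_ *: _).
  by rewrite mulrA mulVf // mul1r.
have kR : k \in Rtau tau.
  by apply: (content_cancel c0 Hc); rewrite -gE; exact: valP.
by exists (RtauElt kR); apply: val_inj; rewrite rmorphM /= -gE.
Qed.

Lemma Rtau_division (tau : padic_family) (k : Rtau_ring tau) (d : nat) :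
  (0 < d)%N -> exists (a : nat) (l : Rtau_ring tau), k = a%:R + d%:R * l.
Proof.
move=> d0; have [a aR] := Rtau_approx d0 (valP k).
exists a, (RtauElt aR); apply: val_inj.
rewrite rmorphD rmorphM !rmorph_nat /= mulr_natl -(scaler_nat d (_ *: _)).
rewrite scalerA divff.
  by rewrite scale1r addrC subrK.
by rewrite pnatr_eq0 -lt0n.
Qed.

Lemma generic_PID (tau : padic_family) : generic tau -> is_PID (Rtau_ring tau).
Proof.
move=> gen; split; first exact: Rtau_domain.
move=> I Iid; have [I0 ID IM] := Iid.
have [[g0 [Ig0 g0n]]|triv] := pselect (exists g, I g /\ g <> 0); last first.
  exists 0; apply/seteqP; split=> [x Ix|x [b ->]] /=; last by rewrite mulr0.
  exists 0; rewrite mul0r; apply: contrapT => xn; apply: triv.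
  by exists x.
have [F [HF [c c0 Ic]]] := ideal_primitive_factor gen Iid Ig0 g0n.
have [d [d0 Id] dmin] : exists2 d, (0 < d)%N /\ I (F * d%:R) &
    forall d', (0 < d')%N /\ I (F * d'%:R) -> (d <= d')%N.
  by apply: nat_minimum; exists c.
exists (F * d%:R); apply/seteqP; split=> [x Ix|x [b ->]] /=; last exact: IM.
have [k xE] := HF x Ix.
have [a [l kE]] := Rtau_division k d0.
have Ir : I (F * (a %% d)%:R).
  have -> : F * (a %% d)%:R = x - ((a %/ d)%:R + l) * (F * d%:R).
    rewrite xE kE {2}(divn_eq a d) natrD natrM; ring.
  by apply: idealB => //; exact: IM.
have r0 : (a %% d)%N = 0%N.
  apply/eqP; rewrite -leqn0 leqNgt; apply/negP => r0.
  by have := dmin _ (conj r0 Ir); rewrite leqNgt ltn_pmod.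
exists ((a %/ d)%:R + l).
rewrite xE kE {1}(divn_eq a d) r0 addn0 natrM; ring.
Qed.

(** * Rings that are not factorial *)

(** By degrees, a factor of a positive integer is constant, and constants in R_tau
    are integers. *)
Lemma Rtau_mul_eq_nat (tau : padic_family) (a b : Rtau_ring tau) (m : nat) :
  (0 < m)%N -> a * b = m%:R ->
  exists i j : int, [/\ a = i%:~R, b = j%:~R & i * j = m%:Z].
Proof.
move=> m0 ab; have abv : val a * val b = m%:R%:P.
  by rewrite polyC_natr -rmorphM ab rmorph_nat.
have mR : m%:R != 0 :> rat by rewrite pnatr_eq0 -lt0n.
have : val a * val b != 0 by rewrite abv polyC_eq0.
rewrite mulf_eq0 negb_or => /andP[a0 b0].
have : size (val a * val b) = 1%N by rewrite abv size_polyC mR.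
rewrite size_mul // => sz.
have sa : (0 < size (val a))%N by rewrite size_poly_gt0.
have sb : (0 < size (val b))%N by rewrite size_poly_gt0.
have /andP[sa1 sb1] : (size (val a) <= 1)%N && (size (val b) <= 1)%N.
  by move: (size _) (size _) sz sa sb => m1 m2; lia.
have aC : val a = ((val a)`_0)%:P by exact: size1_polyC.
have bC : val b = ((val b)`_0)%:P by exact: size1_polyC.
have [i iE] : exists i : int, (val a)`_0 = i%:~R.
  by apply: (@Rtau_const tau); rewrite -aC; exact: valP.
have [j jE] : exists i : int, (val b)`_0 = i%:~R.
  by apply: (@Rtau_const tau); rewrite -bC; exact: valP.
exists i, j; split.
- by apply: val_inj; rewrite rmorph_int aC iE rmorph_int.
- by apply: val_inj; rewrite rmorph_int bC jE rmorph_int.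
- move: abv; rewrite aC bC iE jE -polyCM => /polyC_inj.
  by rewrite -intrM pmulrn => /intr_inj.
Qed.

Lemma two_irreducible (tau : padic_family) :
  is_irreducible (2%:R : Rtau_ring tau).
Proof.
split.
- move/(congr1 val); rewrite rmorph_nat rmorph0 => /eqP.
  by rewrite -polyC_natr polyC_eq0.
- case=> y Hy; have [i [j [iE jE ij]]] := Rtau_mul_eq_nat (ltn0Sn 0) Hy.
  move/(congr1 val): iE; rewrite rmorph_nat rmorph_int -polyC_natr.
  rewrite -(rmorph_int polyC) => /polyC_inj; rewrite pmulrn => /intr_inj iE.
  by move: ij; rewrite -iE; lia.
- move=> a b /esym Hab.
  have [i [j [-> -> ij]]] := Rtau_mul_eq_nat (ltn0Sn 1) Hab.
  have [ii|jj] : i * i = 1 \/ j * j = 1.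
    have /(congr1 absz) := ij; rewrite abszM /= => ijn.
    have : (`|i| %| 2)%N by rewrite -ijn dvdn_mulr.
    rewrite dvdn_divisors // inE => /orP[/eqP i1|]; first by left; lia.
    rewrite inE => /eqP i2; right; have : `|j|%N = 1%N by lia.
    lia.
  + by left; exists i%:~R; rewrite -intrM ii.
  + by right; exists j%:~R; rewrite -intrM jj.
Qed.

(** If factorizations were unique, x would have at least as many irreducible
    factors as factors 2 that can be split off, for which there is no bound. *)
Lemma infinitely_even_not_UFD (tau : padic_family) (x : Rtau_ring tau) :
  x <> 0 -> (forall k, exists y, x = 2%:R ^+ k * y) -> ~ is_UFD (Rtau_ring tau).
Proof.
move=> x0 Hx [_ fact uniq].
have [n20 n2u irr2] := two_irreducible tau.
have n2m (y : Rtau_ring tau) : ~ is_unit (2%:R * y).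
  by case=> z yz; apply: n2u; exists (y * z); rewrite mulrA.
have [s sirr sE] : exists2 s, all_irreducible s & x = \prod_(a <- s) a.
  by apply: fact => //; have [y ->] := Hx 1%N; rewrite expr1; exact: n2m.
pose k := (size s).+1.
have [z zE] := Hx k.+1.
(* One factor 2 is kept in the cofactor, so that it is visibly not a unit. *)
have [t tirr tE] : exists2 t, all_irreducible t & 2%:R * z = \prod_(a <- t) a.
  apply: fact; last exact: n2m.
  by move=> z0; apply: x0; rewrite zE exprSr -mulrA z0 mulr0.
have [||t' [tt' st' _]] := uniq s (nseq k 2%:R ++ t) sirr.
- move=> a; rewrite mem_cat => /orP[|/tirr //].
  by rewrite mem_nseq => /andP[_ /eqP ->]; exact: two_irreducible.
- by rewrite -sE zE big_cat -tE exprSr -mulrA big_nseq -Monoid.iteropE.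
move: st'; rewrite -(perm_size tt') size_cat size_nseq => st'.
by have := leq_addr (size t) k; rewrite -st' ltnn.
Qed.

Lemma iso_PID (R S : comNzRingType) :
  ring_isomorphic R S -> is_PID S -> is_PID R.
Proof.
move=> [f [g fg gf]] [domS PIDS]; have finj := can_inj fg.
split=> [x y xy|I [I0 ID IM]].
  have : f x * f y = 0 by rewrite -rmorphM xy rmorph0.
  by case/domS => H; [left|right]; apply: finj; rewrite H rmorph0.
have [|a Ha] := PIDS [set s | I (g s)]%classic.
  split=> /=; first by rewrite -(rmorph0 f) fg.
  - by move=> x y Ix Iy; rewrite -(gf x) -(gf y) -rmorphD fg; exact: ID.
  - by move=> x y Iy; rewrite -(gf x) -(gf y) -rmorphM fg; exact: IM.
have mem (s : S) : I (g s) <-> exists b, s = b * a.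
  by rewrite -[I (g s)]/([set s | I (g s)]%classic s) Ha.
exists (g a); apply/seteqP; split=> [x Ix|x [b ->]] /=.
  have [|b bE] := (mem (f x)).1; first by rewrite fg.
  by exists (g b); apply: finj; rewrite rmorphM !gf.
by apply: IM; apply/mem; exists 1; rewrite mul1r.
Qed.

(** As rho_2 = 0, the indeterminate is divisible by every power of 2 in R_rho; this
    survives isomorphisms, since they fix the integer 2. *)
Lemma not_UFD_of_iso (sigma rho : padic_family) :
  ring_isomorphic (Rtau_ring sigma) (Rtau_ring rho) ->
  (exists2 p : prime_number, val p = 2%N & rho p = 0) ->
  ~ is_UFD (Rtau_ring sigma).
Proof.
move=> [f [g fg gf]] [p p2 rp0].
have XR : 'X \in Rtau rho by rewrite -QpolyX; exact: Rtau_int.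
pose X : Rtau_ring rho := RtauElt XR.
apply: (@infinitely_even_not_UFD sigma (g X)).
  move/(congr1 f); rewrite gf rmorph0 => /(congr1 val); rewrite rmorph0 /=.
  by move/eqP; rewrite polyX_eq0.
move=> k.
have yR : (2 ^ k)%:R^-1 *: Qpoly 'X \in Rtau rho.
  apply/Rtau_frac; first by rewrite expn_gt0.
  move=> q; rewrite padic_evalX; have [q2|q2] := eqVneq (val q) 2%N.
    have -> : q = p by apply: val_inj; rewrite p2.
    by rewrite rp0 pdvd0.
  rewrite lognX logn_prime // (negbTE q2) muln0; exact: pdvd0n.
exists (g (RtauElt yR)); apply: (can_inj fg).
rewrite rmorphM rmorphXn rmorph_nat !gf; apply: val_inj.
rewrite rmorphM rmorphXn rmorph_nat /= QpolyX -natrX mulr_natl -scaler_nat.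
by rewrite scalerA divff ?scale1r // pnatr_eq0 expn_eq0.
Qed.

(** * Countable colourings of the Cantor space *)

(** Koenig's diagonal argument. View a point of the Cantor space as a sequence
    of rows, each again a point of the Cantor space. If the n-th rows of the
    points of colour n exhaust the space, a section of this projection is
    the required injection; otherwise some y n is missed, and the point
    whose n-th row is y n for all n has no colour. *)
Lemma cantor_color_class (N : (nat -> bool) -> nat) :
  exists n, exists2 g : (nat -> bool) -> (nat -> bool),
    injective g & forall y, N (g y) = n.
Proof.
pose row (n : nat) (c : nat -> bool) (i : nat) := c (pickle (n, i)).
apply: contrapT => noclass.
have /choice[y Hy] : forall n, exists y, forall c, N c = n -> row n c <> y.
  move=> n; apply: contrapT => nex; apply: noclass; exists n.
  have /choice[g Hg] : forall y, exists c, N c = n /\ row n c = y.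
    move=> y; apply: contrapT => nc; apply: nex; exists y => c Nc cy.
    by apply: nc; exists c.
  exists g => [y y' gy|y]; last by case: (Hg y).
  by rewrite -(Hg y).2 -(Hg y').2 gy.
pose c (m : nat) := if unpickle m is Some (n, i) then y n i else false.
apply: (Hy (N c) c erefl); apply/funext => i.
by rewrite /row /c pickleK.
Qed.

Lemma roots_finite (R : comNzRingType) (P : {poly R}) : is_domain R ->
  P != 0 -> exists s : seq R, forall x, root P x -> x \in s.
Proof.
move=> domR; have [n] := ubnP (size P); elim: n P => // n IH P sP P0.
have [[a /factor_theorem[Q PE]]|noroot] :=
  pselect (exists a, root P a); last first.
  by exists [::] => x rx; case: noroot; exists x.
have Q0 : Q != 0 by apply: contra P0 => /eqP Q0; rewrite PE Q0 mul0r.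
have [|s Hs] := IH Q _ Q0.
  by move: sP; rewrite PE size_Mmonic ?monicXsubC // size_XsubC addn2.
exists (a :: s) => x /rootP; rewrite PE hornerM_comm; last exact: mulrC.
rewrite inE hornerXsubC => /domR[/rootP/Hs ->|/subr0_eq ->].
  by rewrite orbT.
by rewrite eqxx.
Qed.

Lemma cantor_not_finite (T : eqType) (g : (nat -> bool) -> T) (s : seq T) :
  injective g -> ~ forall y, g y \in s.
Proof.
move=> ginj gs; pose h (i : nat) := g (fun j => j == i).
have hinj : injective h.
  move=> i j /ginj /(congr1 (fun b => b i)); rewrite eqxx.
  by move/esym/eqP.
have := uniq_leq_size (s1 := map h (iota 0 (size s).+1)) (s2 := s).
rewrite map_inj_uniq // iota_uniq size_map size_iota ltnn => H.
by suff : false by []; apply: H => // x /mapP[i _ ->]; exact: gs.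
Qed.

(** * Transcendental p-adic integers *)

Definition digit_sum (p : nat) (b : nat -> bool) (k : nat) : nat :=
  (\sum_(i < k) b i * p ^ i)%N.

Lemma digit_sumP (p : prime_number) (b : nat -> bool) (k : nat) :
  Ordinal (ltn_pmod (digit_sum (val p) b k.+1) (pexp_gt0 p k.+1)) =
  Ordinal (ltn_pmod (digit_sum (val p) b k) (pexp_gt0 p k)) %[mod val p ^ k].
Proof.
rewrite /= modn_pexpS modn_mod /digit_sum big_ord_recr /= addnC.
by rewrite modnMDl.
Qed.
Definition padic_of_digits (p : prime_number) (b : nat -> bool) : padic_int p :=
  PadicInt (digit_sumP p b).

(** Only the digits 0 and 1 are used, so they are determined by the residues
    even for p = 2. *)
Lemma padic_of_digits_inj (p : prime_number) : injective (padic_of_digits p).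
Proof.
move=> b b' bb'.
have E k : digit_sum (val p) b k = digit_sum (val p) b' k %[mod val p ^ k].
  exact: (congr1 (fun x => val (padic_proj x k)) bb').
have small (e : bool) k : (e * val p ^ k < val p ^ k.+1)%N.
  rewrite expnS ltn_pmul2r ?pexp_gt0 //; have := prime_gt1 (valP p).
  by case: e => //; apply: ltn_trans.
suff S k : digit_sum (val p) b k = digit_sum (val p) b' k.
  apply/funext => k; have := S k.+1; rewrite /digit_sum !big_ord_recr /=.
  rewrite -!/(digit_sum _ _ _) S => /addnI /eqP.
  by rewrite eqn_pmul2r ?pexp_gt0 // => /eqP; case: (b k); case: (b' k).
elim: k => [|k IH]; first by rewrite /digit_sum !big_ord0.
have := E k.+1; rewrite /digit_sum !big_ord_recr /= -!/(digit_sum _ _ _) IH.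
by move/eqP; rewrite eqn_modDl !modn_small ?small // => /eqP ->.
Qed.

(** Colour a point by a nonzero polynomial that vanishes there, if there is one.
    A colour class that belongs to a polynomial maps into its finite set of
    roots, so the large colour class consists of transcendental points. *)
Lemma transcendental_reparametrization (p : prime_number)
    (d : (nat -> bool) -> padic_int p) : injective d ->
  exists2 g : (nat -> bool) -> (nat -> bool), injective g &
    forall y h, h != 0 -> padic_eval h (d (g y)) != 0.
Proof.
move=> dinj.
have /choice[N HN] : forall y, exists o : option {poly int},
    if o is Some h then h != 0 /\ padic_eval h (d y) = 0
    else forall h, h != 0 -> padic_eval h (d y) != 0.
  move=> y; have [[h [h0 hy]]|none] :=
    pselect (exists h : {poly int}, h != 0 /\ padic_eval h (d y) = 0).
    by exists (Some h).
  by exists None => h h0; apply/eqP => hy; apply: none; exists h.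
have [n [g ginj gn]] := cantor_color_class (pickle \o N).
exists g => // y; case Ny: (N (g y)) (HN (g y)) => [h|//] [h0 _].
have hroot z : padic_eval h (d (g z)) = 0.
  have : N (g z) = Some h.
    rewrite -Ny; apply: (pcan_inj pickleK).
    exact: etrans (gn z) (esym (gn y)).
  by case: (N (g z)) (HN (g z)) => // h' [_ hz] [<-].
have P0 : map_poly intr h != 0 :> {poly padic_int p}.
  by rewrite padic_map_poly_eq0.
have [s Hs] := roots_finite (@padic_domain p) P0.
have : injective (d \o g) by exact: inj_comp.
move/(cantor_not_finite (s := s)); case=> z /=; apply/Hs/rootP; exact: hroot.
Qed.

(** * Continuum many generic families *)

Lemma expn_lt_exp2 (C d : nat) :
  exists N, forall n, (N <= n)%N -> (C * n ^ d < 2 ^ n)%N.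
Proof.
(* With q = n / D, n ^ D is at most (D (q + 1)) ^ D, hence at most
   (D 2 ^ q) ^ D, that is D ^ D 2 ^ (q D). The spare factor n in n ^ D
   absorbs C K. *)
pose D := d.+1; pose K := (D ^ D)%N; exists (C * K).+1 => n Nn.
have n0 : (0 < n)%N by apply: leq_trans Nn.
have K0 : (0 < K)%N by rewrite expn_gt0.
have bound : (n ^ D <= K * 2 ^ n)%N.
  have le1 : (n <= D * 2 ^ (n %/ D))%N.
    apply: (@leq_trans (D * (n %/ D).+1)).
      by rewrite ltnW // mulnC ltn_ceil.
    by rewrite leq_mul2l ltn_expl // orbT.
  apply: (@leq_trans ((D * 2 ^ (n %/ D)) ^ D)%N); first by rewrite leq_exp2r.
  rewrite expnMn -/K leq_mul2l -expnM leq_exp2l // leq_trunc_div orbT //.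
have : (C * K * n ^ d < n * n ^ d)%N by rewrite ltn_pmul2r // expn_gt0 n0.
rewrite -expnS => /leq_trans/(_ bound).
by rewrite -mulnA mulnCA ltn_pmul2l.
Qed.

Lemma poly_growth (h : {poly int}) :
  exists C d, forall n, (0 < n)%N -> (`|h.[n%:Z]| <= C * n ^ d)%N.
Proof.
elim/poly_ind: h => [|h c [C [d H]]].
  by exists 0%N, 0%N => n _; rewrite horner0.
exists (C + `|c|)%N, d.+1 => n n0; rewrite hornerD hornerMX hornerC.
apply: (@leq_trans (`|h.[n%:Z]| * n + `|c|)%N).
  by have := leqD_dist (h.[n%:Z] * n%:Z) 0 (- c); lia.
rewrite mulnDl; apply: leq_add.
  by rewrite expnSr mulnA leq_mul2r H // orbT.
by rewrite leq_pmulr // expn_gt0 n0.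
Qed.

Lemma poly_small_value (h : {poly int}) : h != 0 ->
  exists N, forall n, (N <= n)%N -> (0 < `|h.[n%:Z]| < 2 ^ n)%N.
Proof.
move=> h0; have [C [d HC]] := poly_growth h.
have [N1 H1] := expn_lt_exp2 C d.
have int_dom : is_domain int.
  by move=> x y /eqP; rewrite mulf_eq0 => /orP[] /eqP; [left|right].
have [s Hs] := roots_finite int_dom h0.
exists (N1 + (\sum_(x <- s) `|x|).+1)%N => n Nn.
have n1 : (N1 <= n)%N by apply: leq_trans Nn; exact: leq_addr.
have n2 : (\sum_(x <- s) `|x| < n)%N by apply: leq_trans Nn; exact: leq_addl.
have n0 : (0 < n)%N by apply: leq_trans n2.
rewrite (leq_ltn_trans (HC n n0) (H1 n n1)) andbT absz_gt0.
apply/negP => /Hs ns; move: n2; rewrite (big_rem _ ns) /=.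
by rewrite ltnNge leq_addr.
Qed.

Lemma generic_family : exists2 T : (nat -> bool) -> padic_family,
  injective T & forall y, generic (T y).
Proof.
pose a (p : prime_number) := trunc_log 2 (val p).
have pnz (p : prime_number) : (val p)%:R != 0 :> padic_int p.
  by rewrite pmulrn padic_int_eq0 -lt0n prime_gt0 ?(valP p).
have affine_inj (p : prime_number) : injective (fun y : nat -> bool =>
    (a p)%:R + (val p)%:R * padic_of_digits p y).
  move=> y y' /addrI E; apply: (@padic_of_digits_inj p).
  have /padic_domain[pz|/subr0_eq //] :
      (val p)%:R * (padic_of_digits p y - padic_of_digits p y') = 0.
    by rewrite mulrBr E subrr.
  by have := pnz p; rewrite pz eqxx.
have /choice[g Hg] : forall p : prime_number,
    exists g : (nat -> bool) -> (nat -> bool), injective g /\ forall y h, h != 0 ->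
      padic_eval h ((a p)%:R + (val p)%:R * padic_of_digits p (g y)) != 0.
  move=> p.
  have [g gi gt] := transcendental_reparametrization (affine_inj p).
  by exists g.
exists (fun y p => (a p)%:R + (val p)%:R * padic_of_digits p (g p y)).
  (* Any single coordinate separates the family. *)
  move=> y y' E; pose p : prime_number := exist _ 2%N isT.
  apply: (Hg p).1; apply: (affine_inj p).
  exact: (congr1 (fun x : padic_family => x p) E).
move=> y h h0; split=> [p|]; first exact: (Hg p).2.
have [N HN] := poly_small_value h0.
(* From 2 ^ N on, the integer logarithm of p is at least N. *)
exists (2 ^ N)%N => p Np; set x := _ + _; apply/negP => px.
have p0 : (0 < val p)%N by rewrite prime_gt0 ?(valP p).
have /andP[v0 v2] := HN (a p) (trunc_log_max (ltnSn 1) Np).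
have : pdvd 1 (padic_eval h ((a p)%:R : padic_int p)).
  rewrite -[padic_eval _ _](subKr (padic_eval h x)).
  apply: pdvdD => //; rewrite pdvdN; apply: pdvd_eval.
  by rewrite /x addrC addKr; apply: pdvdMr; rewrite pdvd_nat expn1.
rewrite padic_eval_nat pdvd_int expn1 => /(dvdn_leq v0).
rewrite leqNgt (leq_trans v2) // /a.
by have /andP[] := trunc_log_bounds (ltnSn 1) p0.
Qed.

(** * Isomorphism classes are countable *)

(** The polynomial (x - b) / p ^ k belongs to R_rho exactly when rho_p is
    congruent to b modulo p ^ k, so R_rho sees all residues of rho. *)
Lemma Rtau_inj (rho sigma : padic_family) :
  (forall q, q \in Rtau rho -> q \in Rtau sigma) -> rho = sigma.
Proof.
move=> sub; apply: functional_extensionality_dep => p; apply: padic_eq => k.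
have pk : (0 < val p ^ k)%N := pexp_gt0 p k.
pose b := nat_of_ord (padic_proj (rho p) k).
have /sub : (val p ^ k)%:R^-1 *: Qpoly ('X - b%:R) \in Rtau rho.
  apply/Rtau_frac => // q; rewrite padic_evalB padic_evalX padic_eval_natr.
  have [qp|qp] := eqVneq (val q) (val p); last first.
    rewrite lognX logn_prime ?(valP p) // (negbTE qp) muln0; exact: pdvd0n.
  have -> : q = p by apply: val_inj.
  rewrite pfactorK ?(valP p) // pdvdB -val_eqE /= padic_proj_nat /b.
  by rewrite modn_small.
move/(Rtau_frac _ _ pk)/(_ p).
rewrite padic_evalB padic_evalX padic_eval_natr pfactorK ?(valP p) //.
rewrite pdvdB => /eqP ->; apply: val_inj; rewrite /= padic_proj_nat /b.
by rewrite modn_small.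
Qed.

Definition Rtau_X (tau : padic_family) : Rtau_ring tau :=
  RtauElt (Rtau_int tau 'X).

Lemma rmorph_int_horner (A B : comNzRingType) (phi : {rmorphism A -> B})
    (h : {poly int}) (x : A) :
  phi (map_poly intr h).[x] = (map_poly intr h).[phi x].
Proof.
rewrite -horner_map -map_poly_comp; congr (_.[_]).
by apply: eq_map_poly => m /=; rewrite rmorph_int.
Qed.

(** As R_rho has no torsion, a morphism is determined on h / n by its value
    h(f(x)) on h. *)
Lemma Rtau_morph_val (sigma rho : padic_family)
    (f : {rmorphism Rtau_ring sigma -> Rtau_ring rho}) (u : Rtau_ring sigma)
    (n : nat) (h : {poly int}) : (0 < n)%N -> val u = n%:R^-1 *: Qpoly h ->
  val (f u) = n%:R^-1 *: (map_poly intr h).[val (f (Rtau_X sigma))].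
Proof.
move=> n0 uE; have nR : n%:R != 0 :> rat by rewrite pnatr_eq0 -lt0n.
have hE : n%:R * u = (map_poly intr h).[Rtau_X sigma].
  apply: val_inj; rewrite rmorph_int_horner rmorphM rmorph_nat [in LHS]/=.
  rewrite [Rtau_val u]uE mulr_natl -(scaler_nat n (_ *: _)).
  rewrite scalerA divff // scale1r /= QpolyX.
  rewrite -[LHS]comp_polyXr /comp_poly; congr (_.[_]).
  rewrite /Qpoly -map_poly_comp.
  by apply: eq_map_poly => m /=; rewrite -(rmorph_int polyC).
have := congr1 (val \o f) hE; rewrite /= -![Rtau_val _]/(val _).
rewrite rmorphM rmorph_nat !rmorph_int_horner rmorphM rmorph_nat => <-.
by rewrite mulr_natl -(scaler_nat n) scalerA mulVf // scale1r.
Qed.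

Lemma iso_image_X_inj (sigma rho rho' : padic_family)
    (f : {rmorphism Rtau_ring sigma -> Rtau_ring rho})
    (f' : {rmorphism Rtau_ring sigma -> Rtau_ring rho'}) :
  bijective f -> val (f (Rtau_X sigma)) = val (f' (Rtau_X sigma)) ->
  rho = rho'.
Proof.
move=> [g fg gf] X; apply: Rtau_inj => q qR.
pose u := g (RtauElt qR); have [n [h [n0 uE]]] := rat_poly_frac (val u).
have -> : q = val (f' u).
  by rewrite (Rtau_morph_val f' n0 uE) -X -(Rtau_morph_val f n0 uE) gf.
exact: valP.
Qed.

(** Colour y by the image of x under a chosen isomorphism from the representing
    ring onto R_(T y). Within one colour class the representative determines T y,
    hence y. *)
Lemma injective_representatives (J : set padic_family)
    (T : (nat -> bool) -> padic_family) :
  (forall rho : padic_family, exists2 tau : padic_family,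
     J tau & ring_isomorphic (Rtau_ring tau) (Rtau_ring rho)) ->
  injective T ->
  exists2 r : (nat -> bool) -> padic_family, injective r &
    forall y, J (r y) /\
      exists y', ring_isomorphic (Rtau_ring (r y)) (Rtau_ring (T y')).
Proof.
move=> Jrep Tinj.
have /choice[s Hs] : forall y, exists s : padic_family * {poly rat},
    J s.1 /\ exists2 f : {rmorphism Rtau_ring s.1 -> Rtau_ring (T y)},
      bijective f & val (f (Rtau_X s.1)) = s.2.
  move=> y; have [tau Jt [f bf]] := Jrep (T y).
  by exists (tau, val (f (Rtau_X tau))); split=> //; exists f.
have [n [g ginj gn]] := cantor_color_class (fun y => pickle (s y).2).
exists (fun y => (s (g y)).1) => [y y' E|y]; last first.
  have [Jy [f bf _]] := Hs (g y); split=> //.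
  by exists (g y), f.
apply: ginj; apply: Tinj.
have : (s (g y)).2 = (s (g y')).2.
  by apply: (pcan_inj pickleK); rewrite !gn.
have [_ [f bf <-]] := Hs (g y); have [_ [f' _ <-]] := Hs (g y').
move: f bf f'; rewrite -E => f bf f'; exact: iso_image_X_inj.
Qed.

(** * Cardinalities *)

Lemma padic_family_code_inj :
  exists c : padic_family -> (nat -> bool), injective c.
Proof.
exists (fun tau m => if unpickle m is Some (p, k, i) then
  nat_of_ord (padic_proj (tau (p : prime_number)) k) == i else false).
move=> tau rho E; apply: functional_extensionality_dep => p.
apply: padic_eq => k; apply: val_inj => /=.
pose m := pickle (p, k, nat_of_ord (padic_proj (rho p) k)).
have := congr1 (fun c => c m) E.
by rewrite /= /m !pickleK eqxx => /eqP.
Qed.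

Local Open Scope classical_set_scope.
Local Open Scope card_scope.

(** The whole space of families embeds in the Cantor space, by listing residues,
    so only a lower bound has to be supplied. *)
Lemma card_continuum (A : set padic_family)
    (r : (nat -> bool) -> padic_family) :
  injective r -> (forall y, A (r y)) -> A #= [set: nat -> bool].
Proof.
move=> rinj Ar; have [c cinj] := padic_family_code_inj.
apply: Cantor_Bernstein; first by apply/pcard_injP; exists c; apply: in2W.
apply/card_subP; exists (range r); last by move=> _ [y _ <-].
by apply: inj_card_eq; apply: in2W.
Qed.

Theorem proposition3p4 (J : set padic_family)
  (J_repr : forall rho : padic_family,
     exists2 tau : padic_family,
       J tau & ring_isomorphic (Rtau_ring tau) (Rtau_ring rho))
  (J_inj : forall tau sigma : padic_family, J tau -> J sigma -> tau <> sigma ->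
     ~ ring_isomorphic (Rtau_ring tau) (Rtau_ring sigma)) :
  let A := [set tau | J tau /\ is_PID (Rtau_ring tau)] in
  let B := [set tau | J tau /\ ~ is_UFD (Rtau_ring tau)] in
  A #= [set: nat -> bool] /\ B #= [set: nat -> bool].
Proof.
move=> A B; split.
  have [T Tinj Tgen] := generic_family.
  have [r rinj Hr] := injective_representatives J_repr Tinj.
  apply: (card_continuum rinj) => y; have [Jy [y' iso]] := Hr y; split=> //.
  exact: iso_PID iso (generic_PID (Tgen y')).
pose two : prime_number := exist _ 2%N isT.
pose T (y : nat -> bool) : padic_family :=
  fun p => if p == two then 0%R else padic_of_digits p y.
have Tinj : injective T.
  pose three : prime_number := exist _ 3%N isT.
  move=> y y' /(congr1 (fun x : padic_family => x three)).
  exact: padic_of_digits_inj.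
have [r rinj Hr] := injective_representatives J_repr Tinj.
apply: (card_continuum rinj) => y; have [Jy [y' iso]] := Hr y; split=> //.
by apply: not_UFD_of_iso iso _; exists two; rewrite // /T eqxx.
Qed.
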